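(* Let $p>3$ be a prime number, and let $\mathrm{C}(p)$ be the statement: for every $n\ge 1$, every nonsingular $n\times n$ matrix $M$ over $\mathrm{GF}(p)$ and every column vector $\mathbf{v}\in\mathrm{GF}(p)^n$ there exists a nowhere zero vector $\mathbf{x}\in \mathrm{GF}(p)^n$ such that $M\mathbf{x}-\mathbf{v}$ is a nowhere zero vector. Then $\varepsilon_p>1$ implies $\mathrm{C}(p)$, and $\mathrm{C}(p)$ implies $\varepsilon_p\geq \frac12$.
   Context: A vector is nowhere zero if each of its components is nonzero. A hyperplane of a vector space is a subspace of codimension $1$; an affine hyperplane is a set $H+\mathbf{v}$ with $H$ a hyperplane and $\mathbf{v}$ a vector, and $H$ is the hyperplane corresponding to it. A covering of a space is minimal (irredundant) if none of its members can be omitted. For a prime power $q$ and $n\ge 1$, $l_q(n)$ denotes the minimal number $k$ such that there is a collection of $k$ affine hyperplanes of an $n$-dimensional vector space $V$ over $\mathrm{GF}(q)$ which forms a minimal covering of $V$ and for which the intersection of the corresponding hyperplanes is trivial. The number $\varepsilon_q$ is defined by $1+\varepsilon_q=\inf_{n\ge 1} l_q(n)/n$. *)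

(* Defs.v *)
From HB Require Import structures.
From mathcomp Require Import all_boot all_order all_algebra.
From mathcomp Require Import all_classical all_reals.

Set Implicit Arguments.
Unset Strict Implicit.
Unset Printing Implicit Defensive.

Import Order.TTheory GRing.Theory Num.Theory.
Local Open Scope classical_set_scope.
Local Open Scope ring_scope.

Definition nowhere_zero (F : fieldType) (n : nat) (x : 'cV[F]_n) : Prop :=
  forall i, x i 0 != 0.

Definition hyperplane (F : fieldType) (V : vectType F) (H : {vspace V}) : Prop :=
  (\dim H).+1 = \dim {:V}.

Definition translate (F : fieldType) (V : vectType F) (H : {vspace V}) (v : V) :
    set V :=
  [set h + v | h in [set` H]].

(* The members of the collection are [translate (H i) (v i)], with corresponding
   hyperplanes [H i].  Irredundancy forces them to be pairwise distinct, so a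
   family indexed by a type of cardinality k is a collection of k sets. *)
Definition minimal_hyperplane_covering (F : fieldType) (V : vectType F)
    (I : finType) (H : I -> {vspace V}) (v : I -> V) : Prop :=
  [/\ forall i, hyperplane (H i),
      \bigcup_i translate (H i) (v i) = [set: V],
      forall j, \bigcup_(i in [set~ j]) translate (H i) (v i) <> [set: V]
    & (\bigcap_(i : I) H i)%VS = 0%VS].

Definition covering_sizes (F : finFieldType) (n : nat) : set nat :=
  [set k | exists (H : 'I_k -> {vspace 'cV[F]_n}) (v : 'I_k -> 'cV[F]_n),
             minimal_hyperplane_covering H v].

Definition is_least (A : set nat) (k : nat) : Prop :=
  A k /\ forall j, A j -> (k <= j)%N.

(* The default value 0 only occurs for n = 0, see [lqP]. *)
Definition lq (F : finFieldType) (n : nat) : nat :=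
  xget 0%N (is_least (covering_sizes F n)).

Definition epsilon (R : realType) (F : finFieldType) : R :=
  inf [set (lq F n)%:R / n%:R | n in [set n : nat | (0 < n)%N]] - 1.

Definition propertyC (p : nat) : Prop :=
  forall (n : nat), (0 < n)%N ->
  forall (M : 'M['F_p]_n) (v : 'cV['F_p]_n), M \in unitmx ->
  exists x : 'cV['F_p]_n, nowhere_zero x /\ nowhere_zero (M *m x - v).

(* Coverings of the required kind exist for n > 0: take all the x_i = a with
   a != 0, together with x_1 + ... + x_n = 0. *)
Section Existence.
Variables (F : finFieldType) (n' : nat).
Let n := n'.+1.
Let V := 'cV[F]_n.

Let ev (u : 'rV[F]_n) (x : V) : F^o := (u *m x) 0 0.
Let ev_lin u : linear (ev u).
Proof. by move=> a x y; rewrite /ev mulmxDr -scalemxAr !mxE. Qed.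
HB.instance Definition _ u := GRing.isLinear.Build F V F^o _ (ev u) (ev_lin u).
Let ker u : {vspace V} := lker (linfun (ev u)).

Let mem_ker u x : (x \in ker u) = (ev u x == 0).
Proof. by rewrite memv_ker lfunE. Qed.

Let ker_hyp u x : ev u x = 1 -> hyperplane (ker u).
Proof.
move=> e; rewrite /hyperplane -(limg_ker_dim (linfun (ev u)) fullv) capfv -addn1.
congr addn; apply/eqP; rewrite eqn_leq; apply/andP; split; last first.
  by rewrite (leq_trans (dimvS (subvf _))) // dimvf.
rewrite lt0n dimv_eq0; apply/eqP => l0.
have := memv_img (linfun (ev u)) (memvf x).
by rewrite l0 memv0 lfunE /= e oner_eq0.
Qed.

Let I : finType := option ('I_n * {a : F | a != 0}).
Let eb (i : 'I_n) : V := delta_mx i 0.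
Let fm (i : I) : 'rV[F]_n :=
  if i is Some p then delta_mx 0 p.1 else const_mx 1.
Let H i := ker (fm i).
Let v (i : I) : V := if i is Some p then sval p.2 *: eb p.1 else 0.

Let ev_delta i x : ev (delta_mx 0 i) x = x i 0.
Proof. by rewrite /ev -rowE mxE. Qed.

Let ev_cst i a : ev (const_mx 1) (a *: eb i) = a.
Proof.
rewrite linearZ /= /ev mxE (bigD1 i) //= big1 ?addr0; last first.
  by move=> j ji; rewrite !mxE (negPf ji) mulr0.
by rewrite !mxE !eqxx mul1r; apply: mulr1.
Qed.

Let mem_translate (K : {vspace V}) w x : translate K w x <-> x - w \in K.
Proof.
split=> [[h /= hK <-]|xK]; first by rewrite addrK.
by exists (x - w) => //=; rewrite subrK.
Qed.

Let mem_Some i a x : translate (H (Some (i, a))) (v (Some (i, a))) x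
  <-> x i 0 = sval a.
Proof.
rewrite mem_translate mem_ker ev_delta !mxE !eqxx mulr1 subr_eq0.
by split => /eqP.
Qed.

Let mem_None x : translate (H None) (v None) x <-> ev (const_mx 1) x = 0.
Proof. by rewrite mem_translate mem_ker subr0; split => /eqP. Qed.

Lemma covering_exists : minimal_hyperplane_covering H v.
Proof.
split.
- case=> [[i a]|]; first by apply: (@ker_hyp _ (eb i)); rewrite ev_delta mxE !eqxx.
  by apply: (@ker_hyp _ (1 *: eb 0)); rewrite ev_cst.
- apply/seteqP; split=> // x _.
  have [/existsP[i xi]|/existsPn x0] := boolP [exists i, x i 0 != 0].
    by exists (Some (i, exist _ (x i 0) xi)) => //; apply/mem_Some.
  exists None => //; apply/mem_None.
  suff -> : x = 0 by rewrite linear0.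
  by apply/matrixP => i j; rewrite ord1 mxE; apply/eqP; rewrite -[_ == _]negbK.
- case=> [[i a]|] /seteqP[_].
    move=> /(_ (sval a *: eb i) Logic.I) [[[j b]|] /= jN].
      move/mem_Some; rewrite !mxE eqxx andbT.
      have [ji|ji] := eqVneq j i.
        by rewrite mulr1 => /val_inj ba; apply: jN; rewrite ji ba.
      by rewrite mulr0 => b0; have := valP b; rewrite /= -b0 eqxx.
    by move/mem_None; rewrite ev_cst => a0; have := valP a; rewrite /= a0 eqxx.
  move=> /(_ 0 Logic.I) [[[j b]|] /= jN]; last by case: jN.
  by move/mem_Some; rewrite mxE => b0; have := valP b; rewrite /= -b0 eqxx.
- apply/eqP; rewrite -subv0; apply/subvP => x xI; rewrite memv0; apply/eqP.
  apply/matrixP => i j; rewrite ord1 [RHS]mxE.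
  have xk : x \in H (Some (i, exist _ 1 (oner_neq0 F))).
    by move: x xI; apply/subvP; apply: bigcapv_inf.
  by move: xk; rewrite mem_ker ev_delta => /eqP.
Qed.

End Existence.

Lemma covering_card (F : finFieldType) (n : nat) (I : finType)
    (H : I -> {vspace 'cV[F]_n}) (v : I -> 'cV[F]_n) :
  minimal_hyperplane_covering H v -> covering_sizes F n #|I|.
Proof.
case=> hyp cov irr triv.
exists (fun i => H (enum_val i)), (fun i => v (enum_val i)).
split=> [i||j|]; first exact: hyp.
- rewrite -cov; apply/seteqP; split=> x [i _ xi]; first by exists (enum_val i).
  by exists (enum_rank i) => //=; rewrite enum_rankK.
- move=> covj; apply: (irr (enum_val j)); rewrite -covj.
  apply/seteqP; split=> x [i ij xi].
    exists (enum_rank i); last by rewrite /= enum_rankK.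
    by move=> /= e; apply: ij => /=; rewrite -e enum_rankK.
  by exists (enum_val i) => //= /enum_val_inj.
- rewrite -triv [RHS](reindex (@enum_val I predT)) //=.
  by apply: onW_bij; apply: enum_val_bij.
Qed.

Lemma lqP (F : finFieldType) (n : nat) :
  (0 < n)%N -> is_least (covering_sizes F n) (lq F n).
Proof.
case: n => // n _; have /covering_card A0 := covering_exists F n.
have exA : exists k, `[< covering_sizes F n.+1 k >] by eexists; apply/asboolP/A0.
apply: (@xgetPex _ 0%N (is_least (covering_sizes F n.+1))).
case: (ex_minnP exA) => m /asboolP Am mmin.
by exists m; split=> // j Aj; apply/mmin/asboolP.
Qed.

(* Main.v *)
Require Import Defs.
From mathcomp Require Import all_classical all_reals.
From mathcomp Require Import all_boot all_order all_algebra.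
From mathcomp Require Import zify lra.

Set Implicit Arguments.
Unset Strict Implicit.
Unset Printing Implicit Defensive.

Import Order.TTheory GRing.Theory Num.Theory.
Local Open Scope ring_scope.

(** Write the affine hyperplanes as [u i *m x = c i].
    If C(p) fails for [M] and [v], the 2n affine hyperplanes [x_i = 0] and
    [(M x)_i = v_i] cover the space.  A minimal subcover [T] is the union of two
    sets of independent forms, so its rank [m] satisfies [|T| <= 2 m]; modulo the
    common kernel it gives [l_p(m) <= 2 m].
    Conversely, C(p) says that a union of two bases of affine forms is never a
    covering.  In a minimal covering, matroid union gives disjoint independent
    sets [K b] ([b : bool]) and a set [S] containing all forms outside both, such
    that each [K b :&: S] spans [S].  If [S] is everything, there are at least 2n
    forms.  Otherwise some point [x0] is not covered by [S]; on the translate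
    through [x0] of the common kernel of [S] the remaining forms are a union of
    two independent sets, and C(p) yields an uncovered point.  Hence
    [l_p(n) >= 2 n], which is even stronger than the bound 1/2. *)

(** * Span and independence of indexed row vectors *)

Section RowSpan.
Variables (F : fieldType) (n : nat) (I : finType) (u : I -> 'rV[F]_n).
Implicit Types (S T J : {set I}) (e f i : I).

Definition rspan S : 'M[F]_n := (\sum_(i in S) <<u i>>)%MS.

Definition indep S := \rank (rspan S) == #|S|.

Lemma mem_rspan S i : i \in S -> (u i <= rspan S)%MS.
Proof. by move=> iS; rewrite /rspan (sumsmx_sup i) // genmxE. Qed.

Lemma rspan_subP S m (A : 'M_(m, n)) :
  reflect (forall i, i \in S -> (u i <= A)%MS) (rspan S <= A)%MS.
Proof.
apply: (iffP sumsmx_subP) => h i iS; first by rewrite -(genmxE (u i)) h.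
by rewrite genmxE h.
Qed.

Lemma rspanS S T : S \subset T -> (rspan S <= rspan T)%MS.
Proof. by move=> /subsetP sST; apply/rspan_subP => i /sST; apply: mem_rspan. Qed.

Lemma rank_rspan_le S : (\rank (rspan S) <= #|S|)%N.
Proof.
rewrite (leq_trans (mxrank_sum_leqif _).1) //= -sum1_card leq_sum // => i _.
by rewrite mxrank_gen rank_leq_row.
Qed.

Lemma rank_rspan_setD S T : (\rank (rspan T) <= \rank (rspan S) + #|T :\: S|)%N.
Proof.
have /mxrankS : (rspan T <= rspan S + rspan (T :\: S))%MS.
  apply/rspan_subP => i iT; case iS: (i \in S).
    by rewrite (submx_trans (mem_rspan iS)) ?addsmxSl.
  by rewrite (submx_trans _ (addsmxSr _ _)) ?mem_rspan // inE iS.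
move=> /leq_trans; apply; rewrite (leq_trans (mxrank_adds_leqif _ _).1) //.
by rewrite leq_add2l rank_rspan_le.
Qed.

Lemma indep0 : indep set0.
Proof. by rewrite /indep /rspan big_set0 mxrank0 cards0. Qed.

Lemma indepS S T : T \subset S -> indep S -> indep T.
Proof.
move=> sTS /eqP rS; rewrite /indep eqn_leq rank_rspan_le /=.
have := rank_rspan_setD T S; rewrite rS cardsDS //.
by have := subset_leq_card sTS; lia.
Qed.

Lemma indep_dep_mem J e :
  indep J -> ~~ indep (e |: J) -> (u e <= rspan J)%MS.
Proof.
move=> /eqP rJ dep; have [eJ|eJ] := boolP (e \in J); first exact: mem_rspan.
have sJ : (rspan J <= rspan (e |: J))%MS by rewrite rspanS ?subsetUr.
suff : (rspan (e |: J) <= rspan J)%MS.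
  by apply: submx_trans; rewrite mem_rspan ?setU11.
rewrite -(geq_leqif (mxrank_leqif_sup sJ)) rJ -ltnS.
have := rank_rspan_le (e |: J); rewrite leq_eqVlt [_ == _](negPf dep) /=.
by rewrite cardsU1 eJ add1n.
Qed.

(** Expand [u e] over [J]. If [f] has a nonzero coefficient, the expansion can be solved for [u f],
    so exchanging [f] for [e] keeps the span and hence independence; the hypothesis then puts [f] in
    [S]. *)
Lemma mem_rspan_exchange J S e : indep J -> e \notin J -> (u e <= rspan J)%MS ->
    (forall f, f \in J -> indep (e |: J :\ f) -> f \in S) ->
  (u e <= rspan (J :&: S))%MS.
Proof.
move=> /eqP rJ eJ /sub_sumsmxP[a ea] hS.
rewrite ea summx_sub // => f fJ.
have [->|anz] := eqVneq (a f *m <<u f>>%MS) 0; first exact: sub0mx.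
have : (a f *m <<u f>>%MS <= u f)%MS.
  by rewrite (submx_trans (submxMl _ _)) // genmxE.
move=> /sub_rVP[k ek]; rewrite ek scalemx_sub // mem_rspan // inE fJ /=.
apply: hS => //; rewrite /indep eqn_leq rank_rspan_le /=.
have k0 : k != 0 by apply: contraNneq anz => k0; rewrite ek k0 scale0r.
have -> : #|e |: J :\ f| = #|J|.
  by rewrite cardsU1 !inE (negPf eJ) andbF add1n (cardsD1 f J) fJ.
rewrite -rJ mxrankS //; apply/rspan_subP => i iJ.
have [->|nif] := eqVneq i f; last by rewrite mem_rspan // !inE nif iJ orbT.
rewrite -[u f](scalerK k0) -ek scalemx_sub //.
move: ea; rewrite (bigD1 f) //= => /(canLR (addrK _)) <-.
rewrite addmx_sub ?eqmx_opp ?mem_rspan ?setU11 //.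
rewrite summx_sub // => j /andP[jJ jf].
rewrite (submx_trans (submxMl _ _)) // genmxE mem_rspan //.
by rewrite !inE jf jJ orbT.
Qed.

Lemma indep_extend J : indep J ->
  exists J', [/\ J \subset J', indep J' & (rspan setT <= rspan J')%MS].
Proof.
move=> iJ; have [J' /maxsetP[iJ' mJ'] sJ] := maxset_exists iJ.
exists J'; split=> //; apply/rspan_subP => e _.
have [eJ|eJ] := boolP (e \in J'); first exact: mem_rspan.
apply: indep_dep_mem => //; apply: contra eJ => /mJ'/(_ (subsetUr _ _)) <-.
exact: setU11.
Qed.

(** * Pairs of disjoint independent sets and matroid union *)

Implicit Types K : {ffun bool -> {set I}}.

Definition packing K :=
  [&& [forall b, indep (K b)] & [disjoint K true & K false]].

Definition packing_size K := \sum_b #|K b|.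

Definition replace K b J : {ffun bool -> {set I}} :=
  [ffun b' => if b' == b then J else K b'].

Lemma packingP K : reflect ((forall b, indep (K b)) /\
  (forall b i, i \in K b -> i \notin K (~~ b))) (packing K).
Proof.
apply: (iffP andP) => -[]; move=> h d; split.
- exact/forallP.
- case=> i iK /=; first by rewrite (disjointFr d iK).
  by rewrite (disjointFl d iK).
- exact/forallP.
- by rewrite disjoint_subset; apply/subsetP => i /d.
Qed.

Lemma packing_replace K b J : packing K -> indep J ->
  (forall i, i \in J -> i \notin K (~~ b)) -> packing (replace K b J).
Proof.
move=> /packingP[iK dK] iJ dJ; apply/packingP; split=> [b'|b' i].
  by rewrite ffunE; case: ifP.
rewrite !ffunE; have [->|nb] := eqVneq b' b.
  by rewrite (_ : ((~~ b) == b) = false); [move/dJ | case: (b)].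
have -> : ~~ b' = b by case: (b') (b) nb => [] [].
rewrite eqxx => iK'; apply/negP => /dJ/negP; apply.
by move: iK'; have -> : b' = ~~ b by case: (b') (b) nb => [] [].
Qed.

Lemma packing_size_replace K b J :
  (packing_size (replace K b J) + #|K b| = packing_size K + #|J|)%N.
Proof. by rewrite /packing_size !big_bool !ffunE; case: b => /=; lia. Qed.

(** Reachability by single swaps. The entering [e] is missed by both sets, which preserves
    disjointness and total size. *)
Inductive exchangeable K : {ffun bool -> {set I}} -> Prop :=
| exchangeable_refl : exchangeable K K
| exchangeable_step K' b e f : exchangeable K K' ->
    (forall b', e \notin K' b') -> f \in K' b -> indep (e |: K' b :\ f) ->
    exchangeable K (replace K' b (e |: K' b :\ f)).

Lemma exchangeable_packing K K' : packing K -> exchangeable K K' ->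
  packing K' /\ packing_size K' = packing_size K.
Proof.
move=> pK; elim=> // {}K' b e f _ [pK' sK'] eK fK ind; split.
  apply: packing_replace => // i; rewrite !inE => /orP[/eqP->//|/andP[_]].
  by case/packingP: pK' => _; apply.
have := packing_size_replace K' b (e |: K' b :\ f).
rewrite cardsU1 !inE (negPf (eK b)) andbF add1n.
by rewrite sK' (cardsD1 f (K' b)) fK; lia.
Qed.

(* Matroid union for two copies of the row matroid.  With S the set of elements
   missed by some packing reachable from a maximum one, an exchange replaces an
   element of S by another one without leaving the span of the part in S. *)
Lemma max_packing_tight : exists K S,
  [/\ packing K, forall i, i \notin S -> exists b, i \in K b
    & forall b, (rspan S <= rspan (K b :&: S))%MS].
Proof.
have p0 : packing [ffun=> set0].
  by apply/packingP; split=> [b|b i]; rewrite !ffunE ?indep0 ?inE.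
have [K pK maxK] := @arg_maxnP _ _ packing packing_size p0.
pose S := [set e | `[< exists2 K', exchangeable K K' & forall b, e \notin K' b >]].
have memS K' e b : exchangeable K K' -> (forall b, e \notin K' b) ->
    (u e <= rspan (K' b :&: S))%MS.
  move=> exK eK; have [pK' sK'] := exchangeable_packing pK exK.
  have iK' : indep (K' b) by case/packingP: pK'.
  apply: mem_rspan_exchange => // [|f fK ind].
    (* Otherwise adding the missed element [e] would give a packing larger than the maximum. *)
    apply: indep_dep_mem => //; apply/negP => ind.
    have /maxK /= : packing (replace K' b (e |: K' b)).
      apply: packing_replace => // i; rewrite !inE => /orP[/eqP->//|].
      by case/packingP: pK' => _; apply.
    have := packing_size_replace K' b (e |: K' b).
    by rewrite cardsU1 eK sK'; lia.
  (* After the swap [f] is missed by both sets, which witnesses [f \in S]. *)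
  rewrite inE; apply/asboolP; exists (replace K' b (e |: K' b :\ f)).
    exact: exchangeable_step.
  move=> b'; rewrite ffunE; case: eqP => [_|/eqP nb].
    by rewrite !inE eqxx orbF; apply: contraNneq (eK b) => <-.
  have -> : b' = ~~ b by case: (b') (b) nb => [] [].
  by case/packingP: pK' => _; apply.
have spanS K' b : exchangeable K K' ->
    (rspan (K' b :&: S) <= rspan (K b :&: S))%MS.
  (* Induction on the swaps: by [memS] the entering element already lies in the span of the previous
     part in [S]. *)
  elim=> // {}K' b0 e f exK IH eK fK ind; rewrite ffunE.
  case: eqP => // eb; rewrite -eb in fK ind *; apply/rspan_subP => i.
  rewrite !inE => /andP[/orP[/eqP->|/andP[_ iK]] iS].
    exact: submx_trans (memS _ _ b exK eK) IH.
  by apply: submx_trans IH; rewrite mem_rspan // !inE iK.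
exists K, S; split=> // [i iS|b].
  apply/existsP; apply: contraR iS => /existsPn iK.
  by rewrite inE; apply/asboolP; exists K => //; apply: exchangeable_refl.
apply/rspan_subP => e; rewrite inE => /asboolP[K' exK eK].
exact: submx_trans (memS _ _ b exK eK) (spanS _ b exK).
Qed.

End RowSpan.

(** * Hyperplanes as kernels of linear forms *)

Section Forms.
Variables (F : fieldType) (n : nat).
Implicit Types (u : 'rV[F]_n) (x : 'cV[F]_n).

Definition form_ker u : {vspace 'cV[F]_n} :=
  lker (linfun (mulmx u : 'cV[F]_n -> 'M_1)).

Lemma mem_form_ker u x : (x \in form_ker u) = (u *m x == 0).
Proof. by rewrite memv_ker lfunE. Qed.

Lemma form_ker_hyperplane u : u != 0 -> hyperplane (form_ker u).
Proof.
move=> u0; set f := linfun (mulmx u : 'cV[F]_n -> 'M_1).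
rewrite /hyperplane -(limg_ker_dim f fullv) capfv -addn1.
congr addn; apply/eqP; rewrite eqn_leq; apply/andP; split; last first.
  by rewrite (leq_trans (dimvS (subvf _))) // dimvf.
rewrite lt0n dimv_eq0; apply: contraNneq u0 => l0.
apply/eqP/matrixP => i j; rewrite ord1 [RHS]mxE.
have := memv_img f (memvf (delta_mx j 0)).
by rewrite l0 memv0 lfunE /= -colE => /eqP/matrixP/(_ 0 0); rewrite !mxE.
Qed.

Lemma hyperplane_form_ker (H : {vspace 'cV[F]_n}) :
  hyperplane H -> exists u, H = form_ker u.
Proof.
move=> hH; have dn : (\dim H).+1 = n by rewrite hH dimvf /dim /= muln1.
pose B : 'M[F]_(n, \dim H) := \matrix_(i, j) (vbasis H)`_j i 0.
(* [B] has only [n - 1] columns, so some nonzero [u] kills a basis of [H]; equality of dimensions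
   does the rest. *)
have /rowV0Pn[u /sub_kermxP uB u0] : kermx B != 0.
  rewrite -mxrank_eq0 mxrank_ker -lt0n subn_gt0.
  by rewrite (leq_ltn_trans (rank_leq_col _)) // eq_leq.
exists u; apply/eqP; rewrite eqEdim; apply/andP; split; last first.
  by rewrite -ltnS (form_ker_hyperplane u0) hH.
rewrite -(span_basis (vbasisP H)); apply/span_subvP => x.
move=> /tnthP[j ->]; rewrite mem_form_ker.
have <- : col j B = tnth (vbasis H) j.
  by apply/matrixP => i k; rewrite ord1 !mxE (tnth_nth 0).
by rewrite colE mulmxA uB mul0mx.
Qed.

End Forms.

(** * Affine forms and the avoidance property *)

Definition covers (F : fieldType) (n : nat) (I : finType) (u : I -> 'rV[F]_n)
    (c : I -> 'M[F]_1) (S : {set I}) :=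
  forall x, exists2 i, i \in S & u i *m x = c i.

(** C(p) over an arbitrary field; for ['F_p] it unfolds to [propertyC p]. *)
Definition shifted_avoidance (F : fieldType) :=
  forall n, (0 < n)%N -> forall (M : 'M[F]_n) (v : 'cV[F]_n), M \in unitmx ->
  exists x : 'cV[F]_n, nowhere_zero x /\ nowhere_zero (M *m x - v).

Section Avoidance.
Variables (F : fieldType) (n : nat) (I : finType).
Variables (u : I -> 'rV[F]_n) (c : I -> 'M[F]_1).

Lemma spanning_forms_matrix (A : {set I}) :
    (n <= \rank (rspan u A))%N -> (#|A| <= n)%N ->
  exists M b, M \in unitmx /\
    forall z, nowhere_zero (M *m z - b) -> forall i, i \in A -> u i *m z != c i.
Proof.
move=> rA cA; have cAn : n = #|A|.
  by apply/eqP; rewrite eqn_leq cA (leq_trans rA (rank_rspan_le _ _)).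
pose e (j : 'I_n) := enum_val (cast_ord cAn j).
pose M : 'M_n := \matrix_(j < n) u (e j).
exists M, (\col_j c (e j) 0 0).
have eP i : i \in A -> exists j, i = e j.
  move=> iA; exists (cast_ord (esym cAn) (enum_rank_in iA i)).
  by rewrite /e cast_ordKV enum_rankK_in.
split.
  rewrite -row_free_unit -row_leq_rank (leq_trans rA) // mxrankS //.
  apply/rspan_subP => i /eP[j ->].
  by rewrite -(rowK (fun j => u (e j))) row_sub.
move=> z nz i /eP[j ->]; apply: contraNneq (nz j) => ez.
have Mz : (M *m z) j 0 = c (e j) 0 0.
  by rewrite -ez -(rowK (fun j => u (e j))) -row_mul [RHS]mxE.
by rewrite mxE Mz mxE mxE subrr.
Qed.

Lemma avoid_two_spanning (A : bool -> {set I}) : shifted_avoidance F ->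
    (forall b, (n <= \rank (rspan u (A b)))%N) ->
    (forall b, (#|A b| <= n)%N) ->
  exists z, forall b i, i \in A b -> u i *m z != c i.
Proof.
move=> C rA cA; have [n0|n_gt0] := posnP n.
  exists 0 => b i; have /leq_trans/(_ (eq_leq n0)) := cA b.
  rewrite leqn0 cards_eq0 => /eqP->.
  by rewrite inE.
have [M [b [uM hM]]] := spanning_forms_matrix (rA true) (cA true).
have [N [d [uN hN]]] := spanning_forms_matrix (rA false) (cA false).
(* With [x = M z - b], the second condition on [z] becomes one on [N M^-1 x] with shift
   [d - N M^-1 b]. *)
have uNM : N *m invmx M \in unitmx by rewrite unitmx_mul uN unitmx_inv.
have [x [nx nNx]] := C n n_gt0 _ (d - N *m invmx M *m b) uNM.
exists (invmx M *m (x + b)) => -[] i; [apply: hM | apply: hN].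
  by rewrite mulmxA mulmxV // mul1mx addrK.
by move: nNx; rewrite opprB addrA -mulmxDr mulmxA.
Qed.

End Avoidance.

(** * Lower bound for minimal coverings *)

Section LowerBound.
Variables (F : fieldType) (n : nat) (I : finType).
Variables (u : I -> 'rV[F]_n) (c : I -> 'M[F]_1).

Lemma extend_uncovered (S : {set I}) (A : bool -> {set I}) :
    shifted_avoidance F -> (n <= \rank (rspan u setT))%N ->
    (forall b, indep u (A b)) ->
    (forall b, (rspan u S <= rspan u (A b :&: S))%MS) ->
    (forall i, i \notin S -> exists b, i \in A b) ->
  ~ covers u c S -> ~ covers u c setT.
Proof.
move=> C full iA tA outS /existsNP[x0 /forall2NP nx0].
have {}nx0 i : i \in S -> u i *m x0 != c i.
  by move=> iS; case: (nx0 i) => // ne; apply/eqP.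
(* The columns of [N] form a basis of the common kernel of the forms in [S], so moving from [x0]
   along them keeps [S] uncovered. *)
pose Q := cokermx (rspan u S); pose N := col_base Q.
have uN0 i : i \in S -> u i *m N = 0.
  move=> iS; apply: (row_free_inj (row_base_free Q)).
  by rewrite mul0mx -mulmxA mulmx_base; apply/eqP; rewrite -submxE mem_rspan.
have [B hB] : exists B : bool -> {set I}, forall b,
    [/\ A b \subset B b, indep u (B b) & (rspan u setT <= rspan u (B b))%MS].
  have /boolp.choice[B hB] b := indep_extend (iA b).
  by exists B.
pose w i := u i *m N.
have [||z hz] := @avoid_two_spanning _ _ _ w (fun i => c i - u i *m x0)
                  (fun b => B b :\: S) C.
- move=> b; have [_ _ fB] := hB b.
  have fN : row_full N by apply: col_base_full.
  rewrite -{1}(eqP fN) mxrankS //.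
  (* The forms in [B b] span everything, and those in [S] vanish on [N], so the remaining ones span
     the dual of the kernel. *)
  have : (N <= rspan u (B b) *m N)%MS.
    rewrite -{1}[N]mul1mx submxMr // sub1mx -col_leq_rank.
    by rewrite (leq_trans full) ?mxrankS.
  move=> /submx_trans; apply; rewrite sumsmxMr_gen; apply/sumsmx_subP => i iB.
  rewrite genmxE (eqmxMr _ (genmxE _)).
  case iS: (i \in S); first by rewrite uN0 // sub0mx.
  by rewrite (mem_rspan w) // inE iS.
(* Tightness enters here: [B b] has at most [n] elements, at least [\rank (rspan u S)] of them in
   [S], so those outside number at most the dimension of the kernel. *)
- move=> b; have [sAB iB _] := hB b.
  rewrite mxrank_coker.
  have /mxrankS/leq_trans/(_ (rank_rspan_le _ _)) := tA b.
  have := rank_rspan_le u setT.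
  have := subset_leq_card (setSI S sAB).
  have := rank_leq_col (rspan u (B b)); rewrite (eqP iB).
  by rewrite -(cardsID S (B b)); lia.
move=> /(_ (x0 + N *m z))[i _ ei].
have [iS|iS] := boolP (i \in S).
  have /eqP[] := nx0 i iS.
  by rewrite -ei mulmxDr mulmxA uN0 // mul0mx addr0.
have [b iAb] := outS i iS.
have iB : i \in B b :\: S by rewrite inE iS; have [/subsetP->] := hB b.
by have /eqP[] := hz b i iB; rewrite -ei mulmxDr mulmxA addrC addKr.
Qed.

Lemma covering_lower_bound : shifted_avoidance F ->
    (n <= \rank (rspan u setT))%N -> covers u c setT ->
    (forall S : {set I}, S \proper setT -> ~ covers u c S) ->
  (2 * n <= #|I|)%N.
Proof.
move=> C full cov min.
have [K [S [/packingP[iK dK] outS tS]]] := max_packing_tight u.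
have [/eqP ST|nST] := boolP (S == setT); last first.
  have /min nS : S \proper setT by rewrite properT.
  by case: (extend_uncovered C full iK tS outS nS cov).
(* When [S] is everything, both disjoint sets span the whole space. *)
have nK b : (n <= #|K b|)%N.
  rewrite -(eqP (iK b)) (leq_trans full) // mxrankS //.
  by rewrite -[K b]setIT -ST.
have dis : [disjoint K true & K false].
  by rewrite disjoint_subset; apply/subsetP => i /dK.
have := max_card (mem (K true :|: K false)).
rewrite cardsU disjoint_setI0 // cards0.
by have := nK true; have := nK false; lia.
Qed.

End LowerBound.

(** * Passage between hyperplane coverings and affine forms *)

Lemma translate_form_ker (F : fieldType) n (u : 'rV[F]_n) (v x : 'cV[F]_n) :
  translate (form_ker u) v x <-> u *m x = u *m v.
Proof.
split=> [[h /= + <-]|e].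
  by rewrite mem_form_ker mulmxDr => /eqP->; rewrite add0r.
by exists (x - v); rewrite ?subrK //= mem_form_ker mulmxBr e subrr.
Qed.

Lemma covering_sizes_lower_bound (F : finFieldType) n k :
  shifted_avoidance F -> covering_sizes F n k -> (2 * n <= k)%N.
Proof.
move=> C [H [v [hyp cov irr triv]]].
have /boolp.choice[u uH] i := hyperplane_form_ker (hyp i).
rewrite -[leqRHS]card_ord.
apply: (@covering_lower_bound _ _ _ u (fun i => u i *m v i)) => //.
(* The columns of the cokernel lie in every [H i], so trivial intersection means that the forms have
   full rank. *)
- suff Q0 : cokermx (rspan u setT) = 0.
    rewrite leqNgt -subn_gt0 -mxrank_coker.
    by rewrite Q0 mxrank0.
  apply/matrixP => i j; rewrite [RHS]mxE.
  have : col j (cokermx (rspan u setT)) \in (\bigcap_i H i)%VS.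
    rewrite memvE; apply/subv_bigcapP => l _.
    rewrite -memvE uH mem_form_ker colE mulmxA.
    have -> : u l *m cokermx (rspan u setT) = 0.
      by apply/eqP; rewrite -submxE mem_rspan ?inE.
    by rewrite mul0mx.
  by rewrite triv memv0 => /eqP/matrixP/(_ i 0); rewrite !mxE.
- move=> x; have : [set: _]%classic x by [].
  rewrite -cov => -[i _]; rewrite uH => /translate_form_ker ei.
  by exists i; rewrite ?inE.
- move=> S /properP[_ [j _ jS]] covS; apply: (irr j); apply/seteqP; split=> // x _.
  have [i iS ei] := covS x; exists i; last by rewrite uH; apply/translate_form_ker.
  by move=> /= ij; rewrite -ij iS in jS.
Qed.

(** Divide out the common kernel: [R] gives coordinates on the quotient and its right inverse [B]
    lifts points back, so covering and minimality carry over. *)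
Lemma forms_covering_sizes (F : finFieldType) n (I : finType)
    (u : I -> 'rV[F]_n) (c : I -> 'M[F]_1) : (forall i, u i != 0) ->
    covers u c setT -> (forall S : {set I}, S \proper setT -> ~ covers u c S) ->
  covering_sizes F (\rank (rspan u setT)) #|I|.
Proof.
move=> u0 cov min; pose R := row_base (rspan u setT).
have [B RB] : exists B, R *m B = 1%:M by apply/row_freeP/row_base_free.
have uR i : exists w, u i = w *m R.
  by apply/submxP; rewrite eq_row_base mem_rspan ?inE.
move/boolp.choice: uR => [w uR].
have wc i : exists v, w i *m v = c i.
  (* A point left uncovered when [i] is dropped must lie on the [i]-th hyperplane, and so provides
     its translation vector. *)
  have /min/existsNP[x nx] : [set~ i] \proper setT.
    by rewrite properT; apply/eqP => /setP/(_ i); rewrite !inE eqxx.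
  exists (R *m x); have [j _ ej] := cov x.
  have [ji|ji] := eqVneq j i; first by rewrite mulmxA -uR -ji.
  by case: nx; exists j; rewrite ?inE.
move/boolp.choice: wc => [v wv].
have wB i y : u i *m (B *m y) = w i *m y.
  by rewrite uR -mulmxA (mulmxA R) RB mul1mx.
apply: (@covering_card _ _ _ (fun i => form_ker (w i)) v); split.
- move=> i; apply: form_ker_hyperplane; apply: contraNneq (u0 i) => w0.
  by rewrite uR w0 mul0mx.
- apply/seteqP; split=> // y _; have [i _ ei] := cov (B *m y).
  by exists i => //; apply/translate_form_ker; rewrite wv -wB.
- move=> j covj; apply: (min [set~ j]).
    by rewrite properT; apply/eqP => /setP/(_ j); rewrite !inE eqxx.
  move=> x; have : [set: _]%classic (R *m x) by [].
  rewrite -covj => -[i ij /translate_form_ker]; rewrite wv mulmxA -uR => ei.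
  by exists i; rewrite // !inE; apply/eqP.
- apply/eqP; rewrite -subv0; apply/subvP => y yI; rewrite memv0; apply/eqP.
  have By0 i : u i *m (B *m y) = 0.
    apply/eqP; rewrite wB -mem_form_ker; apply: subvP yI.
    exact: bigcapv_inf.
  rewrite -[y]mul1mx -RB -mulmxA.
  have /sub_kermxP : (rspan u setT <= kermx (B *m y))%MS.
    by apply/rspan_subP => i _; apply/sub_kermxP.
  have /submxP[D ->] : (R <= rspan u setT)%MS by rewrite eq_row_base.
  by rewrite -mulmxA => ->; rewrite mulmx0.
Qed.

(** * A small covering from a failure of C(p) *)

Lemma covering_sizes_upper_bound (F : finFieldType) : ~ shifted_avoidance F ->
  exists m k, [/\ (0 < m)%N, covering_sizes F m k & (k <= 2 * m)%N].
Proof.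
move=> /existsNP[n /not_implyP[n_gt0 /existsNP[M /existsNP[a]]]].
move=> /not_implyP[uM nx].
pose I := (bool * 'I_n)%type.
pose A b : 'M_n := if b then 1%:M else M.
have uA b : A b \in unitmx by case: b => //=; apply: unitmx1.
pose u (i : I) := row i.2 (A i.1).
pose c (i : I) : 'M_1 := if i.1 then 0 else row i.2 a.
have cov : covers u c setT.
  move=> x; apply: contrapT => nc; apply: nx; exists x; split=> i.
    apply/eqP => xi; apply: nc; exists (true, i); rewrite ?inE //=.
    by apply/matrixP => j k; rewrite !ord1 /u /= -row_mul mul1mx !mxE.
  apply/eqP => xi; apply: nc; exists (false, i); rewrite ?inE //=.
  apply/matrixP => j k; rewrite !ord1 /u /c /= -row_mul [LHS]mxE [RHS]mxE.
  by apply/eqP; rewrite -subr_eq0 -xi [X in _ == X]mxE [X in _ == _ + X]mxE.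
have [T /minsetP[/asboolP covT minT] _] :=
  @minset_exists _ (fun S => `[< covers u c S >]) setT (introT (asboolP _) cov).
pose J := {i | i \in T}.
pose u' (j : J) := u (val j).
pose c' (j : J) := c (val j).
have TJ i : i \in T -> exists j : J, val j = i.
  by move=> iT; exists (exist _ i iT).
(* Each half of [T] consists of rows of an invertible matrix, hence is independent. *)
have rT b : (#|[set i in T | i.1 == b]| <= \rank (rspan u' setT))%N.
  apply: (@leq_trans (\rank (rspan u [set i in T | i.1 == b]))); last first.
    rewrite mxrankS //; apply/rspan_subP => i; rewrite inE => /andP[/TJ[j <-] _].
    by rewrite (mem_rspan u') ?inE.
  rewrite leq_eqVlt; apply/orP; left; rewrite eq_sym.
  apply: (@indepS _ _ _ u [set i | i.1 == b]).
    by apply/subsetP => i; rewrite !inE => /andP[].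
  have cb : #|[set i : I | i.1 == b]| = n.
    have -> : [set i : I | i.1 == b] = setX [set b] setT.
      by apply/setP => i; rewrite !inE andbT.
    by rewrite cardsX cards1 cardsT card_ord mul1n.
  rewrite /indep cb eqn_leq rank_leq_row /= -{1}(mxrank_unit (uA b)) mxrankS //.
  by apply/row_subP => i; apply: (@mem_rspan _ _ _ u _ (b, i)); rewrite inE /=.
have cT : (#|T| <= 2 * \rank (rspan u' setT))%N.
  have := rT true; have := rT false.
  have := cardsID [set i : I | i.1] T.
  have -> : T :&: [set i | i.1] = [set i in T | i.1 == true].
    by apply/setP => i; rewrite !inE eqb_id.
  have -> : T :\: [set i | i.1] = [set i in T | i.1 == false].
    by apply/setP => i; rewrite !inE andbC eqbF_neg.
  by lia.
have cJ : #|{: J}| = #|T| by rewrite card_sig.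
exists (\rank (rspan u' setT)), #|{: J}|; split; last by rewrite cJ.
  (* Since [T] covers the origin it is nonempty, and [cT] then forces positive rank. *)
  have [i iT _] := covT 0; have : (0 < #|T|)%N by apply/card_gt0P; exists i.
  by lia.
apply: (@forms_covering_sizes _ _ _ u' c').
- move=> j; apply/eqP => u0; have := uA (val j).1; rewrite -row_free_unit.
  have : (delta_mx 0 (val j).2 : 'rV_n) *m A (val j).1 = 0 *m A (val j).1.
    by rewrite -rowE mul0mx.
  move=> e /row_free_inj -/(_ _ _ _ e)/matrixP/(_ 0 (val j).2)/eqP.
  by rewrite !mxE !eqxx oner_eq0.
- by move=> x; have [i /TJ[j <-] ei] := covT x; exists j; rewrite ?inE.
- move=> S /properP[_ [j _ jS]] covS.
  have sT : [set val i | i in S] \subset T.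
    by apply/subsetP => _ /imsetP[i _ ->]; apply: valP.
  have ST : [set val i | i in S] = T.
    apply: minT => //; apply/asboolP => x; have [i iS ei] := covS x.
    by exists (val i) => //; apply: imset_f.
  have /setP/(_ (val j)) := ST.
  by rewrite (mem_imset _ _ val_inj) (negPf jS) (valP j).
Qed.

(** * Passage to the infimum *)

Theorem mainTheorem8 (R : realType) (p : nat) (p_prime : prime p)
    (p_gt3 : (3 < p)%N) :
  (1 < epsilon R 'F_p -> propertyC p) /\
  (propertyC p -> 1 / 2 <= epsilon R 'F_p).
Proof.
split=> [|C].
  rewrite ltNge => /negP ne; apply: contrapT => nC; apply: ne.
  have [m [k [m_gt0 Ak km]]] := covering_sizes_upper_bound nC.
  rewrite lerBlDr (@le_trans _ _ ((lq 'F_p m)%:R / m%:R)) //.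
    (* The ratio at [m] bounds the infimum because all ratios are bounded below by 0. *)
    apply: ge_inf; last by exists m.
    by exists 0 => _ [j _ <-]; rewrite divr_ge0.
  rewrite ler_pdivrMr ?ltr0n // -[_ + 1]/(2%:R) -natrM ler_nat.
  by rewrite (leq_trans _ km) // (lqP _ m_gt0).2.
(* All ratios are at least 2, so the infimum minus 1 is even at least 1. *)
rewrite /epsilon; set E := (X in inf X); suff : 2 <= inf E by lra.
apply: lb_le_inf; first by exists ((lq 'F_p 1)%:R / 1%:R); exists 1%N.
move=> _ [n /= n_gt0 <-]; rewrite ler_pdivlMr ?ltr0n // -natrM ler_nat.
exact: covering_sizes_lower_bound C (lqP _ n_gt0).1.
Qed.
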